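(* Let $K$ be locally compact and discretely valued. Let $f\in K[x]$ be a univariate polynomial that splits over $K$, and let $B_0\in\mathcal B^1$ be a rational disc of positive radius containing a root of $f$. Let $B_0,B_1,B_2,\dots$ be a sequence of discs obtained by running the best-first gradient descent algorithm with objective $\ell=|f|$ indefinitely, i.e. for every $i\ge0$ one chooses (possibly at random) a tangent direction $\vec v$ minimising $d_{\vec v}\ell$ over $\{\vec v_{B_iC}: C\in\mathcal C(B_i)\}$ and sets $B_{i+1}=B_i+\vec v$. Then this sequence converges (in $\mathcal B^1$) to a root of $f$ in $K$.
   Context: $K$ is a field with a non-trivial valuation $\mathrm{val}\colon K\to\mathbb R\cup\{\infty\}$, complete with respect to the associated non-Archimedean absolute value $|a|=\exp(-\mathrm{val}(a))$. $\hat K$ is the completion of an algebraic closure of $K$, with the unique extension of $|\cdot|$. For $a\in K$, $r\in\mathbb R_{\ge0}$ put $B_{\mathcal B}(a,r)=\{z\in\hat K: |a-z|\le r\}$; $\mathcal B^1$ is the set of all of these discs, and $K\subseteq\mathcal B^1$ via $a\mapsto B_{\mathcal B}(a,0)$. The metric on $\mathcal B^1$ is $d_{\mathcal B}(B_{\mathcal B}(a,r),B_{\mathcal B}(a',r'))=|r-r'|$ if one disc contains the other, and $d_{\mathcal B}(B,B')=d_{\mathcal B}(B,B\vee B')+d_{\mathcal B}(B\vee B',B')$ with $B\vee B'=B_{\mathcal B}(a,|a-a'|)$ otherwise. Any two points of $(\mathcal B^1,d_{\mathcal B})$ are joined by a unique geodesic up to parametrisation. For $f\in K[x]$, $|f|(B)=\sup_{z\in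 B}|f(z)|$. A disc $B_{\mathcal B}(a,r)$ is rational if $r\in|K|$. For a rational disc $B$ of positive radius, $\mathcal C(B)$ is the (finite) set of its children: the rational discs $C\subsetneq B$ such that no rational disc lies strictly between $C$ and $B$. For $B\neq B'$, $\vec v_{BB'}$ denotes the tangent direction at $B$ given by the class of the geodesic from $B$ to $B'$, two geodesics emanating from $B$ being equivalent if they share a non-trivial initial segment. The directional derivative of a function $\ell\colon\mathcal B^1\to\mathbb R$ along $\vec v=\overline\gamma$, with $\gamma$ a unit-speed geodesic starting at $B$, is $d_{\vec v}\ell=\lim_{h\to0^+}(\ell(\gamma(h))-\ell(B))/h$. For $\vec v=\overline\gamma$ a tangent direction at a rational disc $B$, $B+\vec v$ is the closest rational disc to $B$ (other than $B$) on the path $\gamma$; in particular $B+\vec v_{BC}=C$ for a child $C\in\mathcal C(B)$. *)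

(* Defs.v *)
From HB Require Import structures.
From mathcomp Require Import all_boot all_order all_algebra.
From mathcomp Require Import all_classical all_reals all_analysis.
From mathcomp Require Import lra.

Set Implicit Arguments.
Unset Strict Implicit.
Unset Printing Implicit Defensive.

Import Order.TTheory GRing.Theory Num.Theory.
Import numFieldNormedType.Exports.

Local Open Scope classical_set_scope.
Local Open Scope ring_scope.

Record valuation (R : realType) (K : fieldType) := Valuation {
  valuation_fun :> K -> \bar R;
  valuation_neqNy : forall a, valuation_fun a != -oo%E;
  valuation_eqy : forall a, valuation_fun a = +oo%E <-> a = 0;
  valuationM : forall a b,
    valuation_fun (a * b) = (valuation_fun a + valuation_fun b)%E;
  valuationD : forall a b,
    (mine (valuation_fun a) (valuation_fun b) <= valuation_fun (a + b))%E }.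

Section ValuedField.
Context {R : realType} {K : fieldType}.
Implicit Types (v : valuation R K) (a b : K).

(* [expeR -oo = 0], so that [absv v 0 = 0]. *)
Definition absv v a : R := fine (expeR (- v a)%E).

Lemma absv_ge0 v a : 0 <= absv v a.
Proof. by rewrite /absv fine_ge0// expeR_ge0. Qed.

Definition absv_nng v a : {nonneg R} := NngNum (absv_ge0 v a).

Lemma absv_eq0 v a : absv v a = 0 -> a = 0.
Proof.
rewrite /absv; case E : (v a) => [r| |] /=.
- by move=> e0; have := expR_gt0 (- r); rewrite e0 ltxx.
- by move=> _; apply/(valuation_eqy v).
- by have := valuation_neqNy v a; rewrite E.
Qed.

Lemma absv0 v : absv v 0 = 0.
Proof. by rewrite /absv (proj2 (valuation_eqy v 0) erefl). Qed.

Lemma valuationN v a : v (- a) = v a.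
Proof.
have fin c : c != 0 -> v c \is a fin_num.
  move=> c0; rewrite fin_numE valuation_neqNy /=.
  by apply/eqP => /(valuation_eqy v)/eqP; rewrite (negPf c0).
have e1 := valuationM v 1 1; have eN := valuationM v (-1) (-1).
have f1 := fin 1 (oner_neq0 _).
have fN : v (-1) \is a fin_num by apply: fin; rewrite oppr_eq0 oner_neq0.
rewrite mulrNN !mulr1 in e1 eN.
rewrite -mulN1r valuationM.
move: e1 eN; rewrite -(fineK f1) -(fineK fN) -!EFinD => -[e1] [eN].
have -> : fine (v (-1)) = 0 by lra.
by rewrite add0e.
Qed.

Lemma absv_distC v a b : absv v (a - b) = absv v (b - a).
Proof. by rewrite /absv -(opprB b a) valuationN. Qed.

Lemma absvD v a b : absv v (a + b) <= absv v a + absv v b.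
Proof.
have fin c : expeR (- v c)%E \is a fin_num.
  by have := valuation_neqNy v c; case: (v c).
have : (expeR (- v (a + b)%R) <= maxe (expeR (- v a)) (expeR (- v b)))%E.
  have := valuationD v a b.
  rewrite ge_min le_max !lee_expeR !leeN2.
  exact.
rewrite le_max => /orP[] h.
- by apply: (@le_trans _ _ (absv v a)); [rewrite fine_le|rewrite lerDl absv_ge0].
- by apply: (@le_trans _ _ (absv v b)); [rewrite fine_le|rewrite lerDr absv_ge0].
Qed.

Definition nontrivial_valuation v := exists2 a, a != 0 & v a != 0%E.

Definition discrete_valuation v := exists2 s : R, 0 < s &
  [set x : R | exists2 a, a != 0 & v a = x%:E] = range (fun m : int => m%:~R * s).

(* The field [K] viewed as a metric space with distance [|x - y|]; indexing the
   alias by [v] lets the topology be inferred. *)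
Definition valued v : Type := K.

HB.instance Definition _ v := Choice.on (valued v).
HB.instance Definition _ v := isPointed.Build (valued v) (0 : K).

Definition dist_valued v (x y : valued v) : R := absv v ((x : K) - (y : K)).

Lemma dist_valuedxx v (x : valued v) : dist_valued x x = 0.
Proof. by rewrite /dist_valued subrr absv0. Qed.

Lemma dist_valued_eq0 v (x y : valued v) : dist_valued x y = 0 -> x = y.
Proof. by move=> /absv_eq0/eqP; rewrite subr_eq0 => /eqP. Qed.

Lemma dist_valuedC v (x y : valued v) : dist_valued x y = dist_valued y x.
Proof. exact: absv_distC. Qed.

Lemma dist_valued_triangle v (y x z : valued v) :
  dist_valued x z <= dist_valued x y + dist_valued y z.
Proof. by rewrite /dist_valued -(subrKA (y : K)) absvD. Qed.

HB.instance Definition _ v := @isMetric.Build R (valued v) (@dist_valued v)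
  (@dist_valuedxx v) (@dist_valued_eq0 v) (@dist_valuedC v) (@dist_valued_triangle v).

Definition complete_valuation v :=
  forall F : set_system (valued v), ProperFilter F -> cauchy F -> cvg F.

Definition locally_compact_valuation v := locally_compact [set: valued v].

End ValuedField.

(* [Khat], with absolute value [absv w] and embedding [iota], is the completion
   of an algebraic closure [L] of [K].  As [K] is complete, there is exactly one
   absolute value on [L] extending that of [K], so the one that [w] induces on
   [L] is it. *)
Definition completed_algebraic_closure (R : realType) (K Khat : fieldType)
    (v : valuation R K) (w : valuation R Khat) (iota : {rmorphism K -> Khat}) :=
  [/\ forall a, w (iota a) = v a,
      complete_valuation w &
      exists (L : closedFieldType) (i : {rmorphism K -> L})
             (j : {rmorphism L -> Khat}),
        [/\ forall x, algebraicOver i x,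
            forall a, j (i a) = iota a &
            dense (range j : set (valued w))]].

Section DiscSpace.
Context {R : realType} {K Khat : fieldType}.
Variables (v : valuation R K) (w : valuation R Khat).
Variable iota : {rmorphism K -> Khat}.

Definition disc (a : K) (r : {nonneg R}) : set Khat :=
  [set z | absv w (iota a - z) <= r%:num].

Definition discs : set (set Khat) := [set B | exists a r, B = disc a r].

Definition mkdisc (a : K) (r : {nonneg R}) : discs :=
  exist _ (disc a r)
    (mem_set (ex_intro _ a (ex_intro _ r erefl : exists r', disc a r = disc a r'))).

Implicit Types B C D : discs.

Lemma disc_repr B : exists p : K * {nonneg R}, val B = disc p.1 p.2.
Proof. by have [a [r E]] := set_valP B; exists (a, r). Qed.

(* A presentation B(a, r) of [B] is chosen once and for all.  When [Khat] is
   algebraically closed and non-trivially valued, |Khat^*| is dense in the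
   positive reals: then [disc_radius B] is determined by [B], and [disc_dist] does
   not depend on the choice of [disc_center]. *)
Definition disc_center B : K := (projT1 (cid (disc_repr B))).1.
Definition disc_radius B : R := (projT1 (cid (disc_repr B))).2%:num.

Definition disc_join B C : discs :=
  mkdisc (disc_center B) (absv_nng v (disc_center B - disc_center C)).

Definition disc_dist B C : R :=
  if `[< val B `<=` val C \/ val C `<=` val B >] then `|disc_radius B - disc_radius C|
  else `|disc_radius B - disc_radius (disc_join B C)| + `|disc_radius (disc_join B C) - disc_radius C|.

Definition rational_disc B := exists a b : K, B = mkdisc a (absv_nng v b).

Definition children B : set discs := [set C | [/\ rational_disc C,
  val C `<` val B &
  forall D, rational_disc D -> ~ (val C `<` val D /\ val D `<` val B)]].

(* Unit-speed geodesics of positive length, starting at time 0; the values of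
   [geod_fun] outside [0, geod_len] are irrelevant. *)
Record geodesic := Geodesic {
  geod_fun :> R -> discs;
  geod_len : R;
  geod_len_gt0 : 0 < geod_len;
  geod_unit_speed : {in `[0, geod_len] &, forall s t,
    disc_dist (geod_fun s) (geod_fun t) = `|s - t|} }.

Definition same_direction (g g' : geodesic) :=
  exists e : R, [/\ 0 < e, e <= geod_len g, e <= geod_len g' &
    {in `[0, e], forall t, g t = g' t}].

(* Tangent directions are classes of geodesics for [same_direction]. *)
Definition direction B C : set geodesic :=
  [set g | exists g' : geodesic,
     [/\ g' 0 = B, g' (geod_len g') = C & same_direction g' g]].

(* The common value, for the geodesics in the class [d], of the one-sided
   derivative at the origin. *)
Definition dir_derivative (l : discs -> R) (d : set geodesic) : R :=
  get [set x : R | exists2 g : geodesic, d g &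
         (l (g h) - l (g 0)) / h @[h --> 0^'+] --> x].

(* [rational_step B d D] means D = B + d. *)
Definition rational_step B (d : set geodesic) D :=
  exists2 g : geodesic, d g &
    let on_path X := exists2 t, t \in `[0, geod_len g] & g t = X in
    [/\ rational_disc D, D <> B, on_path D &
        forall X, rational_disc X -> X <> B -> on_path X ->
          disc_dist B D <= disc_dist B X].

Definition steepest_direction (l : discs -> R) B (d : set geodesic) :=
  (exists2 C, children B C & d = direction B C) /\
  (forall C, children B C -> dir_derivative l d <= dir_derivative l (direction B C)).

Definition best_first_descent (l : discs -> R) (B : nat -> discs) :=
  forall i, exists2 d, steepest_direction l (B i) d
                     & rational_step (B i) d (B i.+1).

Definition poly_abs (f : {poly K}) B : R :=
  sup [set absv w (map_poly iota f).[z] | z in val B].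

End DiscSpace.

Definition splits_over (K : fieldType) (f : {poly K}) :=
  exists (c : K) (rs : seq K), f = c *: \prod_(a <- rs) ('X - a%:P).

(* Main.v *)
Require Import Defs.
From HB Require Import structures.
From mathcomp Require Import all_boot all_order all_algebra.
From mathcomp Require Import all_classical all_reals all_analysis.
From mathcomp Require Import lra.

Set Implicit Arguments.
Unset Strict Implicit.
Unset Printing Implicit Defensive.

Import Order.TTheory GRing.Theory Num.Theory.
Import numFieldNormedType.Exports.

Local Open Scope classical_set_scope.
Local Open Scope ring_scope.

(** Let [pi] be a uniformiser.  The children of B(c, r) are the discs
B(d, |pi| r) with d in B(c, r), and the geodesic from B(c, r) to such a child
is s |-> B(d, s).  For |pi| r < s <= r one has |f|(B(d, s)) = A s^m, where m is
the number of roots of f in the child and A > 0 does not depend on s, so the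
slope towards the child is - A m r^(m-1): it is negative exactly when the child
contains a root.  Hence if B_i contains a root then so does any child of least
slope, the radii are multiplied by |pi| at each step, and, as f has finitely
many roots, one of them lies in all the discs B_i.  For f = 0 the common point
comes from completeness instead. *)

(** * Absolute values and the gap in a discrete value group *)

Section AbsoluteValue.
Context {R : realType} {K : fieldType} (v : valuation R K).
Implicit Types (a b c : K).

Lemma valuation_fin a : a != 0 -> v a \is a fin_num.
Proof.
move=> a0; rewrite fin_numE valuation_neqNy /=.
by apply/eqP => /(valuation_eqy v)/eqP; rewrite (negPf a0).
Qed.

Lemma absv_expR a : a != 0 -> absv v a = expR (- fine (v a)).
Proof. by move=> /valuation_fin; rewrite /absv; case: (v a). Qed.

Lemma absv_gt0 a : a != 0 -> 0 < absv v a.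
Proof. by move=> /absv_expR->; exact: expR_gt0. Qed.

Lemma absvM a b : absv v (a * b) = absv v a * absv v b.
Proof.
have [->|a0] := eqVneq a 0; first by rewrite mul0r absv0 mul0r.
have [->|b0] := eqVneq b 0; first by rewrite mulr0 absv0 mulr0.
rewrite !absv_expR ?mulf_neq0// valuationM fineD ?valuation_fin//.
by rewrite -expRD opprD.
Qed.

Lemma absv1 : absv v 1 = 1.
Proof.
have u1 : absv v 1 != 0 by rewrite gt_eqF// absv_gt0// oner_neq0.
by apply: (mulIf u1); rewrite -absvM !mul1r.
Qed.

Lemma absvX a n : absv v (a ^+ n) = absv v a ^+ n.
Proof. by elim: n => [|n IH]; rewrite ?expr0 ?absv1// !exprS absvM IH. Qed.

Lemma absvV a : absv v a^-1 = (absv v a)^-1.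
Proof.
have [->|a0] := eqVneq a 0; first by rewrite invr0 absv0 invr0.
have ua : absv v a != 0 by rewrite gt_eqF// absv_gt0.
by apply: (mulIf ua); rewrite -absvM !mulVf// absv1.
Qed.

Lemma absv_prod (I : Type) (s : seq I) (F : I -> K) :
  absv v (\prod_(a <- s) F a) = \prod_(a <- s) absv v (F a).
Proof. exact: (big_morph _ absvM absv1). Qed.

Lemma ln_absvXz a (k : int) : a != 0 ->
  ln (absv v (a ^ k)) = k%:~R * ln (absv v a).
Proof.
move=> /absv_gt0 a0; case: k => n.
  by rewrite -exprnP absvX lnXn// mulr_natl.
by rewrite NegzE -exprnN absvV absvX lnV ?posrE ?exprn_gt0// lnXn// mulrNz mulNr mulr_natl.
Qed.

Lemma absvN a : absv v (- a) = absv v a.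
Proof. by rewrite /absv valuationN. Qed.

Lemma absvD_max a b : absv v (a + b) <= Num.max (absv v a) (absv v b).
Proof.
have fin c : expeR (- v c)%E \is a fin_num.
  by have := valuation_neqNy v c; case: (v c).
have := valuationD v a b; rewrite ge_min le_max => /orP[] h; apply/orP.
- by left; rewrite fine_le// lee_expeR leeN2.
- by right; rewrite fine_le// lee_expeR leeN2.
Qed.

Lemma absvB_trans b a c : absv v (a - c) <= Num.max (absv v (a - b)) (absv v (b - c)).
Proof. by rewrite -(subrKA b) absvD_max. Qed.

Lemma absvB_trans_le b a c (r : R) :
  absv v (a - b) <= r -> absv v (b - c) <= r -> absv v (a - c) <= r.
Proof. by move=> h1 h2; apply: le_trans (absvB_trans b _ _) _; rewrite ge_max h1. Qed.

(** One bound is the ultrametric inequality through [b]. For the other, the inequality through [a]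
    bounds [|b - c|] by the larger of [|b - a|] and [|a - c|], and the former is too small. *)
Lemma absvB_isosceles b a c :
  absv v (a - b) < absv v (b - c) -> absv v (a - c) = absv v (b - c).
Proof.
move=> h; apply/eqP; rewrite eq_le; apply/andP; split.
  by apply: absvB_trans_le (ltW h) _.
have := absvB_trans a b c; rewrite le_max (absv_distC _ b a).
by rewrite [in X in X || _]leNgt h.
Qed.

(** A positive generator [s] of the value group is the valuation of a uniformiser [t]. Valuations
    are multiples of [s], so a strict inequality between absolute values improves by the factor
    [|t|]. *)
Lemma discrete_absv : discrete_valuation v ->
  exists2 t : K, 0 < absv v t < 1 &
    forall a b, absv v a < absv v b -> absv v a <= absv v t * absv v b.
Proof.
case=> s s0 vE.
have [t t0 vt] : exists2 a, a != 0 & v a = s%:E.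
  suff : [set x : R | exists2 a, a != 0 & v a = x%:E] s by [].
  by rewrite vE; exists 1 => //; rewrite mulr1z mul1r.
have at_ : absv v t = expR (- s) by rewrite absv_expR// vt.
have absE a : a != 0 -> exists m : int, absv v a = expR (- (m%:~R * s)).
  move=> a0; suff [m _ mE] : range (fun m : int => m%:~R * s) (fine (v a)).
    by exists m; rewrite absv_expR// -mE.
  by rewrite -vE; exists a => //; rewrite fineK// valuation_fin.
exists t; first by rewrite at_ expR_gt0 expR_lt1; lra.
move=> a b ab.
have b0 : b != 0.
  by apply: contraTneq ab => ->; rewrite absv0 ltNge absv_ge0.
have [->|a0] := eqVneq a 0; first by rewrite absv0 mulr_ge0 ?absv_ge0.
move: ab; have [m ->] := absE _ a0; have [n ->] := absE _ b0.
rewrite ltr_expR ltrN2 ltr_pM2r// ltr_int at_ -expRD ler_expR => nm.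
suff : (n%:~R + 1) * s <= m%:~R * s by lra.
by rewrite ler_pM2r// -intrD1 ler_int lezD1.
Qed.

End AbsoluteValue.

(** * Density of the absolute values of [Khat] *)

Section Density.
Context {R : realType} {K Khat : fieldType}.
Variables (v : valuation R K) (w : valuation R Khat).
Variable iota : {rmorphism K -> Khat}.

Definition absv_dense := forall r s : R, 0 <= r < s -> exists z : Khat, r < absv w z < s.

(** For [t] in [K] with [|t| > 1], a root of X^n - t^p in the algebraic closure has absolute value
    |t|^(p/n), and the rationals p/n are dense. *)
Lemma absv_closure_dense : nontrivial_valuation v ->
  completed_algebraic_closure v w iota -> absv_dense.
Proof.
case=> b b0 vb [wv _ [L [i [j [_ ji _]]]]].
have absvji a : absv w (j (i a)) = absv v a by rewrite ji /absv wv.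
have [t t0 t1] : exists2 t, t != 0 & 0 < ln (absv v t).
  have : ln (absv v b) != 0.
    rewrite absv_expR// expRK oppr_eq0; apply: contraNneq vb => vb0.
    by rewrite -(fineK (valuation_fin v b0)) vb0.
  rewrite neq_lt => /orP[h|h]; last by exists b.
  exists b^-1; first by rewrite invr_eq0.
  by rewrite absvV lnV ?posrE ?absv_gt0// oppr_gt0.
have dense_pos r s : 0 < r < s -> exists z, r < absv w z < s.
  move=> /andP[r0 rs]; have s0 := lt_trans r0 rs.
  have : ln r / ln (absv v t) < ln s / ln (absv v t).
    by rewrite ltr_pM2r ?invr_gt0// ltr_ln.
  (* The exponent [q] is a rational strictly between the logarithms of [r] and [s] to the base
     [|t|]. *)
  move=> /rat_in_itvoo[q]; rewrite in_itv/= => /andP[].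
  rewrite ltr_pdivrMr// ltr_pdivlMr//.
  have [n n0 nE] : exists2 n : nat, (0 < n)%N & denq q = n.
    by exists `|denq q|%N; rewrite ?absz_gt0 ?gtz0_abs ?denq_gt0.
  rewrite /ratr nE => h1 h2.
  have [x] : exists x, root ('X^n - (i (t ^ numq q))%:P) x.
    by apply/closed_rootP; rewrite size_XnsubC// eqSS -lt0n.
  rewrite rootE !hornerE subr_eq0 => /eqP xn.
  have n0' : (0 : R) < n%:R by rewrite ltr0n.
  have w0 : 0 < absv w (j x).
    rewrite absv_gt0// fmorph_eq0; apply: contra_neq (expfz_neq0 (numq q) t0) => x0.
    by apply/eqP; rewrite -(fmorph_eq0 i) -xn x0 expr0n gtn_eqF.
  have lnE : ln (absv w (j x)) = (numq q)%:~R / n%:R * ln (absv v t).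
    apply: (@mulrI _ (n%:R : R)); first by rewrite unitfE gt_eqF.
    rewrite mulr_natl -lnXn// -absvX -rmorphXn xn absvji ln_absvXz//.
    by rewrite mulrA [X in _ = X * _]mulrCA divff ?mulr1// gt_eqF.
  exists (j x); rewrite -[r < _]ltr_ln ?posrE// -[_ < s]ltr_ln ?posrE//.
  by rewrite lnE h1 h2.
move=> r s /andP[]; rewrite le_eqVlt => /predU1P[<- s0|r0 rs]; last first.
  by apply: dense_pos; rewrite r0.
have [|z /andP[z1 z2]] := dense_pos (s / 2) s; first by lra.
by exists z; rewrite z2 andbT; lra.
Qed.

End Density.

(** * Inclusion of discs and the distance between them *)

Section Discs.
Context {R : realType} {K Khat : fieldType}.
Variables (v : valuation R K) (w : valuation R Khat).
Variable iota : {rmorphism K -> Khat}.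
Hypothesis w_extends : forall a, w (iota a) = v a.
Hypothesis w_dense : absv_dense w.

Implicit Types (a b c d : K) (r s t : R).

Local Notation "`| a |v" := (absv v a) (at level 0, format "`| a |v").

Lemma absv_iota a : absv w (iota a) = `|a|v.
Proof. by rewrite /absv w_extends. Qed.

Lemma absv_iotaB a b : absv w (iota a - iota b) = `|a - b|v.
Proof. by rewrite -rmorphB absv_iota. Qed.

(* B(c, |r|): radii are kept in [R], to be used with [0 <= r]. *)
Definition discR c r : discs w iota := mkdisc w iota c (`|r|%:nng).

Lemma in_discR c r z : 0 <= r ->
  val (discR c r) z <-> absv w (iota c - z) <= r.
Proof. by move=> r0; rewrite /= /disc/= ger0_norm. Qed.

Lemma in_discR_iota c r a : 0 <= r ->
  val (discR c r) (iota a) <-> `|c - a|v <= r.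
Proof. by move=> r0; rewrite in_discR// absv_iotaB. Qed.

Lemma mkdiscE c (r : {nonneg R}) : mkdisc w iota c r = discR c r%:num.
Proof. by congr mkdisc; apply/val_inj; rewrite /= ger0_norm. Qed.

Lemma discsP B : exists c r, 0 <= r /\ B = discR c r.
Proof.
have [[c r] /= E] := disc_repr B; exists c, r%:num; split=> //.
by rewrite -mkdiscE; exact: val_inj.
Qed.

Lemma discR_sub c r d s : 0 <= r -> 0 <= s ->
  val (discR d s) `<=` val (discR c r) <-> `|c - d|v <= r /\ s <= r.
Proof.
move=> r0 s0; split=> [sub|[cd sr] z].
  have cd : `|c - d|v <= r.
    by apply/in_discR_iota/sub/in_discR_iota => //; rewrite subrr absv0.
  split=> //; rewrite leNgt; apply/negP => rs.
  (* With r < |z| < s, the point d - z lies in B(d, s) but farther than r from d, hence outside B(c,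
     r) = B(d, r). *)
  have [|z /andP[z1 z2]] := w_dense (r := r) (s := s); first by rewrite r0.
  have : val (discR c r) (iota d - z).
    by apply/sub/in_discR => //; rewrite opprB addrC subrK ltW.
  move/in_discR => /(_ r0) h; move: z1; rewrite ltNge => /negP; apply.
  rewrite -[z](subKr (iota d)).
  by apply: absvB_trans_le h; rewrite absv_iotaB absv_distC.
move/in_discR => /(_ s0) h; apply/in_discR => //.
by apply: (@absvB_trans_le _ _ w (iota d)); rewrite ?absv_iotaB// (le_trans h).
Qed.

Lemma eq_discR c r d s : 0 <= r -> 0 <= s ->
  discR c r = discR d s <-> `|c - d|v <= r /\ r = s.
Proof.
move=> r0 s0; split=> [E|[cd <-]].
  have [cd sr] : `|c - d|v <= r /\ s <= r by apply/discR_sub; rewrite ?E.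
  have [_ rs] : `|d - c|v <= s /\ r <= s by apply/discR_sub; rewrite ?E.
  by split=> //; apply/eqP; rewrite eq_le rs.
by apply/val_inj/seteqP; split; apply/discR_sub; rewrite // 1?absv_distC.
Qed.

(** The chosen presentation may use another centre of the same disc, whereas its radius is
    determined by the disc as a set. *)
Lemma disc_centerP c r : 0 <= r -> exists2 d, `|c - d|v <= r &
  disc_center (discR c r) = d /\ disc_radius (discR c r) = r.
Proof.
move=> r0; rewrite /disc_center /disc_radius.
case: cid => -[d s] /= E.
have : discR c r = mkdisc w iota d s by exact: val_inj.
by rewrite mkdiscE => /eq_discR => /(_ r0 (ge0 s))[cd <-]; exists d.
Qed.

Lemma disc_radiusE c r : 0 <= r -> disc_radius (discR c r) = r.
Proof. by move=> r0; have [? _ []] := disc_centerP c r0. Qed.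

(** The maximum is the radius of the smallest disc containing both: the distance climbs to it from
    [r] and descends to [s]. For nested discs it is the larger radius. *)
Lemma disc_distE c r d s : 0 <= r -> 0 <= s ->
  disc_dist v (discR c r) (discR d s) = Num.max `|c - d|v (Num.max r s) *+ 2 - r - s.
Proof.
move=> r0 s0; rewrite /disc_dist !disc_radiusE//; case: asboolP => [h|].
  have {}h : `|c - d|v <= Num.max r s.
    rewrite le_max; case: h => /discR_sub.
      by move=> /(_ s0 r0)[]; rewrite absv_distC => ->; rewrite orbT.
    by move=> /(_ r0 s0)[->].
  rewrite (max_r h); have [rs|sr] := leP r s.
    by rewrite ler0_norm; lra.
  by rewrite gtr0_norm; lra.
rewrite /disc_join; have [c' cc' [-> _]] := disc_centerP c r0.
have [d' dd' [-> _]] := disc_centerP d s0.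
rewrite mkdiscE /= disc_radiusE ?absv_ge0//.
move=> /not_orP[]; rewrite !discR_sub// => h1 h2.
have rj : Num.max r s < `|c - d|v.
  rewrite ltNge le_max; apply/negP; rewrite absv_distC => h.
  have [rs|sr] := leP r s.
    by apply: h1; split=> //; case/orP: h => // h; exact: le_trans h rs.
  apply: h2; split; last exact: ltW.
  by rewrite absv_distC; case/orP: h => // h; exact: le_trans h (ltW sr).
(* Moving each centre within its own disc shifts it by less than [|c - d|], which leaves the
   distance unchanged. *)
have -> : `|c' - d'|v = `|c - d|v.
  move: rj; rewrite gt_max => /andP[rj sj].
  have e1 : `|c' - d|v = `|c - d|v.
    by apply: absvB_isosceles; rewrite absv_distC (le_lt_trans cc').
  rewrite -e1 (absv_distC v c' d') (absv_distC v c' d); apply: absvB_isosceles.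
  by rewrite (absv_distC v d') (absv_distC v d c') e1 (le_lt_trans dd').
have /andP[j1 j2] : (r < `|c - d|v) && (s < `|c - d|v) by rewrite -gt_max.
rewrite (max_l (ltW rj)) ler0_norm ?gtr0_norm; lra.
Qed.

Lemma disc_dist_nested c r s : 0 <= r -> 0 <= s ->
  disc_dist v (discR c r) (discR c s) = `|r - s|.
Proof.
move=> r0 s0; rewrite disc_distE// subrr absv0 (@max_r _ _ 0) ?le_max ?r0//.
have [rs|sr] := leP r s; first by rewrite ler0_norm; lra.
by rewrite gtr0_norm; lra.
Qed.

(** Equality in the triangle inequality reads j1 + j2 = r + u, where u is the radius of [X]. As j1
    >= r and j2 >= u, both are equalities, and j2 = u puts [c] in [X]. *)
Lemma disc_dist_between c r s X : 0 <= s <= r ->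
  disc_dist v (discR c r) X + disc_dist v X (discR c s) = r - s ->
  X = discR c (r - disc_dist v (discR c r) X) /\ disc_dist v (discR c r) X <= r - s.
Proof.
move=> /andP[s0 sr]; have r0 := le_trans s0 sr.
have [d [u [u0 ->]]] := discsP X; rewrite !disc_distE// (absv_distC v d).
set j1 := Num.max _ _; set j2 := Num.max _ _ => h.
have : (`|c - d|v <= j1) && ((r <= j1) && (u <= j1)) by rewrite -!ge_max.
have : (`|c - d|v <= j2) && ((u <= j2) && (s <= j2)) by rewrite -!ge_max.
move=> /and3P[? ? ?] /and3P[? ? ?].
have -> : j1 = r by lra.
split; last by lra.
by apply/eq_discR => //; rewrite 1?absv_distC; [lra|split; lra].
Qed.

(* A geodesic that starts towards the centre c cannot leave B(c, r - e) afterwards. *)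
Lemma disc_dist_beyond c r e X t : 0 < e <= r ->
  disc_dist v (discR c r) X = t -> disc_dist v (discR c (r - e)) X = t - e ->
  exists2 d, `|c - d|v <= r - e & X = discR d (r - t) /\ e <= t <= r.
Proof.
move=> /andP[e0 er]; have r0 : 0 <= r by lra.
have re : 0 <= r - e by lra.
have [d [u [u0 ->]]] := discsP X; rewrite !disc_distE//.
set j1 := Num.max _ _; set j2 := Num.max _ _ => h1 h2.
have : (`|c - d|v <= j2) && ((r - e <= j2) && (u <= j2)) by rewrite -!ge_max.
move=> /and3P[j2c j2r j2u].
(* Subtracting the two distance formulas gives j1 = j2 + e, so j1 exceeds both [|c - d|] and [u]. *)
have j1r : j1 = r.
  have : j1 = `|c - d|v \/ j1 = r \/ j1 = u.
    rewrite /j1; case: leP => _; [|by left]; right; case: leP; by [left|right].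
  by case=> [|[]] => ?; lra.
have j2e : j2 = r - e by lra.
exists d; first by rewrite -j2e.
by split; [congr discR|]; lra.
Qed.

End Discs.

(** * Children, radial geodesics and one step of the algorithm *)

Section Descent.
Context {R : realType} {K Khat : fieldType}.
Variables (v : valuation R K) (w : valuation R Khat).
Variable iota : {rmorphism K -> Khat}.
Hypothesis w_extends : forall a, w (iota a) = v a.
Hypothesis w_dense : absv_dense w.

Implicit Types (a b c d : K) (r s t : R).

Local Notation "`| a |v" := (absv v a) (at level 0, format "`| a |v").
Local Notation discR := (discR w iota).

Variable pi : K.
Hypothesis pi01 : 0 < `|pi|v < 1.
Hypothesis pi_gap : forall a b, `|a|v < `|b|v -> `|a|v <= `|pi|v * `|b|v.

Lemma pi_shrink b : b != 0 -> 0 < `|pi|v * `|b|v < `|b|v.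
Proof.
case/andP: pi01 => p0 p1 /(absv_gt0 v) b0.
by rewrite mulr_gt0// gtr_pMl.
Qed.

Lemma rational_discR c b : rational_disc v (discR c `|b|v).
Proof. by exists c, b; rewrite mkdiscE. Qed.

Lemma rational_discR_inv c r : 0 <= r -> rational_disc v (discR c r) ->
  exists b, r = `|b|v.
Proof.
move=> r0 [a [b]]; rewrite mkdiscE => /(eq_discR w_extends w_dense).
by move=> /(_ r0 (absv_ge0 _ _))[_ ->]; exists b.
Qed.

Lemma discR_proper c r d s : 0 <= r -> 0 <= s ->
  val (discR d s) `<` val (discR c r) <-> `|c - d|v <= r /\ s < r.
Proof.
move=> r0 s0; split=> [[/(discR_sub w_extends w_dense) h1 h2]|[cd sr]].
  have {h1}[cd sr] := h1 r0 s0; split=> //; rewrite ltNge; apply/negP => rs.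
  apply: h2; apply/discR_sub => //; split=> //.
  by rewrite absv_distC (le_trans cd).
split; first by apply/discR_sub => //; split=> //; exact: ltW.
by move=> /(discR_sub w_extends w_dense) h; have [_] := h s0 r0; rewrite leNgt sr.
Qed.

(** By the gap, a smaller rational disc has radius at most [|pi b|]. If it is smaller still, the
    disc of radius [|pi b|] about the same centre lies strictly between. *)
Lemma children_discR c b C : b != 0 -> children v (discR c `|b|v) C <->
  exists2 d, `|c - d|v <= `|b|v & C = discR d (`|pi|v * `|b|v).
Proof.
move=> /pi_shrink /andP[p0 p1]; have b0 := absv_ge0 v b.
rewrite -absvM in p0 p1 *; split=> [[[d [e]]]|[d cd ->]].
  rewrite mkdiscE /= => ->{C} /discR_proper => /(_ b0 (absv_ge0 _ _))[cd eb] noD.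
  exists d => //; suff -> : `|e|v = `|pi * b|v by [].
  apply/eqP; rewrite eq_le [in X in X && _]absvM pi_gap// leNgt.
  apply/negP => h; apply: (noD (discR d `|pi * b|v)); first exact: rational_discR.
  split; apply/discR_proper => //; rewrite ?absv_ge0// subrr absv0.
  by rewrite h absv_ge0.
split; first exact: rational_discR.
  by apply/discR_proper; rewrite ?absv_ge0.
move=> D [d' [e ->]]; rewrite mkdiscE/= => -[].
move=> /discR_proper h1 /discR_proper h2.
have [_ {}h1] := h1 (absv_ge0 _ _) (absv_ge0 _ _).
have [_ /pi_gap] := h2 (absv_ge0 _ _) (absv_ge0 _ _).
by rewrite -absvM leNgt h1.
Qed.

Lemma radial_unit_speed c r s : 0 <= s ->
  {in `[0, r - s] &, forall t u,
    disc_dist v (discR c (r - t)) (discR c (r - u)) = `|t - u|}.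
Proof.
move=> s0 t u; rewrite !in_itv/= => /andP[t0 tr] /andP[u0 ur].
rewrite disc_dist_nested//; [|lra|lra].
by rewrite distrC; congr `|_|; lra.
Qed.

(** The underlying path is inferred from [radial_unit_speed]: at time [t] it is at B(c, r - t), so
    it ends at B(c, s). *)
Definition radial c r s (s0 : 0 <= s) (rs : 0 < r - s) : geodesic v w iota :=
  Geodesic rs (radial_unit_speed c s0).

(** A representative ending at B(c, s) has length r - s, so each of its points gives equality in the
    triangle inequality and is concentric. Other members of the class share an initial segment with
    such a representative. *)
Lemma direction_radial c r s g : 0 <= s < r ->
  direction (v := v) (discR c r) (discR c s) g ->
  exists e, [/\ 0 < e, e <= r - s, e <= geod_len g &
    {in `[0, e], forall t, g t = discR c (r - t)}].
Proof.
move=> /andP[s0 sr] [g' [g'0 g'L [e [e0 eg' eg same]]]].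
have L0 := geod_len_gt0 g'; have r0 : 0 <= r by lra.
have distg' t : t \in `[0, geod_len g'] ->
    disc_dist v (discR c r) (g' t) = t /\
    disc_dist v (g' t) (discR c s) = geod_len g' - t.
  move=> ht; have := ht; rewrite in_itv/= => /andP[t0 tL].
  rewrite -g'0 -[in X in _ /\ X]g'L !geod_unit_speed ?in_itv/= ?lexx ?(ltW L0)//.
  by rewrite sub0r normrN ger0_norm// ler0_norm; lra.
have LE : geod_len g' = r - s.
  have [] := distg' (geod_len g'); first by rewrite in_itv/= lexx ltW.
  by rewrite g'L disc_dist_nested// gtr0_norm; lra.
exists e; split=> //; first by rewrite -LE.
move=> t ht; have := ht; rewrite in_itv/= => /andP[t0 te].
have [|h1 h2] := distg' t; first by rewrite in_itv/= t0 LE; lra.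
rewrite -same//.
have [] := @disc_dist_between _ _ _ v w iota w_extends w_dense c r s (g' t).
- by rewrite s0 ltW.
- by rewrite h1 h2 LE; lra.
by rewrite h1.
Qed.

Lemma radial_direction c r s (s0 : 0 <= s) (rs : 0 < r - s) :
  direction (discR c r) (discR c s) (radial c s0 rs).
Proof.
exists (radial c s0 rs) => /=; split; rewrite ?subr0 ?subKr//.
by exists (r - s); split.
Qed.

(** All geodesics of the class agree with the radial one near time 0, so their difference quotients
    have one common limit. The class contains [radial], hence [get] returns that limit. *)
Lemma dir_derivative_radial (l : discs w iota -> R) (phi : R -> R) c r s (D : R) :
  0 <= s < r -> {in `]s, r], forall t, l (discR c t) = phi t} ->
  (phi (r - h) - phi r) / h @[h --> 0^'+] --> D ->
  dir_derivative (v := v) l (direction (discR c r) (discR c s)) = D.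
Proof.
move=> /andP[s0 sr] lphi phiD.
have cvg_dir g : direction (v := v) (discR c r) (discR c s) g ->
    (l (g h) - l (g 0)) / h @[h --> 0^'+] --> D.
  move=> /direction_radial[|e [e0 ers eg gE]]; first by rewrite s0.
  apply: cvg_trans phiD; apply: near_eq_cvg; near=> h.
  have h0 : 0 < h by [].
  have he : h < e by near: h; exact: nbhs_right_lt.
  rewrite !gE ?in_itv/= ?lexx ?(ltW h0) ?(ltW he) ?(ltW e0)//.
  by rewrite subr0 !lphi// in_itv/= ?lexx ?andbT//; apply/andP; lra.
apply: get_unique.
  have rs : 0 < r - s by lra.
  by exists (radial c s0 rs); [exact: radial_direction|exact/cvg_dir/radial_direction].
move=> x [g /cvg_dir gD gx]; exact: cvg_unique gx gD.
Unshelve. all: by end_near. Qed.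

(** The class controls a geodesic only up to some time [e]. If [D] occurs by then, its radius is
    forced by the gap; if later, the geodesic must still pass through the child, and minimality
    applies. *)
Lemma rational_step_child c b D : b != 0 ->
  rational_step (v := v) (discR c `|b|v)
    (direction (discR c `|b|v) (discR c (`|pi|v * `|b|v))) D ->
  D = discR c (`|pi|v * `|b|v).
Proof.
move=> b0; have /andP[p0 p1] := pi_shrink b0.
set r := `|b|v in p0 p1 *; set s := `|pi|v * r in p0 p1 *.
have r0 : 0 <= r by exact: absv_ge0.
case=> g /direction_radial[|e [e0 ers eg gE]]; first by rewrite ltW.
case=> Drat DB [t0 + gt0] Dmin; rewrite in_itv/= => /andP[t00 t0L].
have g0 : g 0 = discR c r by rewrite gE ?subr0// in_itv/= lexx ltW.
have distBg t : 0 <= t <= geod_len g -> disc_dist v (discR c r) (g t) = t.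
  move=> /andP[t1 t2]; rewrite -g0 geod_unit_speed ?in_itv/= ?lexx ?t1//=.
    by rewrite sub0r normrN ger0_norm.
  by lra.
have t0_gt0 : 0 < t0.
  by rewrite lt_def t00 andbT; apply: contra_notN DB => /eqP t0E; rewrite -gt0 t0E.
have rat_le a t : 0 < t -> r - t = `|a|v -> r - t <= s.
  by move=> t_gt0 tE; rewrite tE pi_gap// -tE -/r; lra.
have [t0e|et0] := leP t0 e.
  have DE : D = discR c (r - t0) by rewrite -gt0 gE// in_itv/= t00.
  have rt0 : 0 <= r - t0 by lra.
  have [x xE] : exists x, r - t0 = `|x|v by apply: (@rational_discR_inv c); rewrite -?DE.
  by rewrite DE; congr (discR _ _); have := rat_le _ _ t0_gt0 xE; lra.
have distB : disc_dist v (discR c r) D = t0 by rewrite -gt0 distBg// t00.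
have distE : disc_dist v (discR c (r - e)) D = t0 - e.
  rewrite -gt0 -gE ?in_itv/= ?lexx ?(ltW e0)// geod_unit_speed ?in_itv/= ?t00//.
    by rewrite distrC gtr0_norm// subr_gt0.
  by rewrite (ltW e0).
have [|d cd [DE /andP[_ t0r]]] := disc_dist_beyond w_extends w_dense _ distB distE.
  by rewrite e0; lra.
(* The distance is at most r - e < r, so the gap lowers it to [s]: [c] and [d] are centres of the
   same child. *)
have {}cd : `|c - d|v <= s by rewrite pi_gap// -/r; lra.
have rt0 : 0 <= r - t0 by lra.
have [x xE] : exists x, r - t0 = `|x|v by apply: (@rational_discR_inv d); rewrite -?DE.
have st0 := rat_le _ _ t0_gt0 xE.
have CE : discR c s = discR d s by apply/eq_discR => //; rewrite ltW.
have BE : discR c r = discR d r by apply/eq_discR => //; split=> //; lra.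
(* At time r - s the path lies between B(d, r) and [D] = B(d, r - t0), hence is concentric with
   them. *)
have gC : g (r - s) = discR d s.
  have dL : disc_dist v (discR d r) (g (r - s)) = r - s by rewrite -BE distBg//; lra.
  have [||] := @disc_dist_between _ _ _ v w iota w_extends w_dense d r (r - t0) (g (r - s)).
  - by rewrite rt0; lra.
  - rewrite dL -DE -gt0 geod_unit_speed ?in_itv/= ?t00//; last lra.
    by rewrite distrC ger0_norm; lra.
  by rewrite dL subKr.
have : disc_dist v (discR c r) D <= disc_dist v (discR c r) (discR c s).
  apply: Dmin.
  - by rewrite /s /r -absvM; exact: rational_discR.
  - by move/eq_discR => /(_ v w_extends w_dense (ltW p0) r0)[_ sr]; lra.
  - by exists (r - s); [rewrite in_itv/=; lra|rewrite gC CE].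
rewrite distB disc_dist_nested ?(ltW p0)// gtr0_norm ?subr_gt0// => t0rs.
by rewrite CE DE; congr (discR _ _); lra.
Qed.

End Descent.

(** * One-sided derivative of a monomial, and a product split by a predicate *)

Lemma cvg_quotient_monomial (R : realType) (A r : R) (m : nat) :
  (A * (r - h) ^+ m - A * r ^+ m) / h @[h --> 0^'+] --> - (A * (m%:R * r ^+ m.-1)).
Proof.
apply: cvg_dnbhs_at_right.
have dP : is_derive (0 : R) (1 : R) (fun h : R => A * (r - h) ^+ m) (- (A * (m%:R * r ^+ m.-1))).
  have -> : (fun h : R => A * (r - h) ^+ m) = cst A * ((cst r - id) ^+ m).
    by apply/funext => h; rewrite [RHS]/GRing.mul/= exprfctE.
  apply: is_derive_eq; have -> : (cst r - id) 0 = r - 0 :> R by [].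
  by rewrite subr0 sub0r scaler0 addr0 /GRing.scale/= mulrN1 mulrN.
have [/cvg_ex[/= l hl] <-] := dP.
rewrite /derive (cvg_lim _ hl)//.
apply: cvg_trans hl; apply: near_eq_cvg; near=> h.
by rewrite /= addr0 subr0 [h%:A]mulr1; exact: mulrC.
Unshelve. all: by end_near. Qed.

Lemma prod_if (S : comPzSemiRingType) (I : Type) (rs : seq I) (P : pred I) (s : S) (F : I -> S) :
  \prod_(a <- rs) (if P a then s else F a) =
  s ^+ count P rs * \prod_(a <- rs | ~~ P a) F a.
Proof.
rewrite (bigID P) /=; congr (_ * _); last by apply: eq_bigr => a /negPf->.
rewrite (eq_bigr (fun=> s)) => [|a ->//].
by rewrite big_const_seq iter_mulr_1.
Qed.

(** * Values of [|f|] on discs and slopes towards children *)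

Section RootProduct.
Context {R : realType} {K Khat : fieldType}.
Variables (v : valuation R K) (w : valuation R Khat).
Variable iota : {rmorphism K -> Khat}.
Hypothesis w_extends : forall a, w (iota a) = v a.
Hypothesis w_dense : absv_dense w.

Implicit Types (a b c d : K) (r s t : R).

Local Notation "`| a |v" := (absv v a) (at level 0, format "`| a |v").
Local Notation discR := (discR w iota).

Variable pi : K.
Hypothesis pi01 : 0 < `|pi|v < 1.
Hypothesis pi_gap : forall a b, `|a|v < `|b|v -> `|a|v <= `|pi|v * `|b|v.

Lemma absv_horner_split (k : K) (rs : seq K) z :
  absv w (map_poly iota (k *: \prod_(a <- rs) ('X - a%:P))).[z] =
  `|k|v * \prod_(a <- rs) absv w (iota a - z).
Proof.
rewrite map_polyZ hornerZ absvM (absv_iota w_extends) rmorph_prod horner_prod absv_prod.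
by congr (_ * _); apply: eq_bigr => a _; rewrite /= map_polyXsubC hornerXsubC absv_distC.
Qed.

(** On B(c, s) a factor [|a - z|] is at most [s] for roots in the child and at most [|c - a|] for
    the others. Points at distance from [c] just below [s] come arbitrarily close to all these
    bounds at once; [s] itself need not be an absolute value. *)
Lemma poly_abs_near (k : K) (rs : seq K) c b s : k != 0 -> b != 0 ->
  `|pi|v * `|b|v < s <= `|b|v ->
  let P a := `|c - a|v <= `|pi|v * `|b|v in
  poly_abs (k *: \prod_(a <- rs) ('X - a%:P)) (discR c s) =
  `|k|v * \prod_(a <- rs | ~~ P a) `|c - a|v * s ^+ count P rs.
Proof.
move=> k0 b0 /andP[ps sb] P; have /andP[p0 p1] := pi_shrink pi01 b0.
set A := `|k|v * _; have s0 : 0 < s by apply: lt_trans ps.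
have A0 : 0 < A.
  rewrite mulr_gt0 ?absv_gt0// prodr_gt0// => a; rewrite /P -ltNge.
  exact: lt_trans.
have farP a : ~~ P a -> `|b|v <= `|c - a|v.
  by move=> Pa; rewrite leNgt; apply: contra Pa => /pi_gap.
have valE t : `|k|v * \prod_(a <- rs) (if P a then t else `|c - a|v) = A * t ^+ count P rs.
  by rewrite prod_if mulrCA mulrC.
rewrite /poly_abs; set E := image _ _.
have ubE : ubound E (A * s ^+ count P rs).
  move=> _ [z /in_discR zs <-]; have {zs}cz := zs (ltW s0).
  rewrite absv_horner_split -valE ler_wpM2l ?absv_ge0// ler_prod// => a _.
  rewrite absv_ge0/=; case: ifPn => Pa.
    apply: (absvB_trans_le (b := iota c) _ cz).
    by rewrite (absv_iotaB w_extends) absv_distC; exact: le_trans Pa (ltW ps).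
  apply: (absvB_trans_le (b := iota c)); first by rewrite (absv_iotaB w_extends) absv_distC.
  by rewrite (le_trans cz)// (le_trans sb)// farP.
have E0 : E !=set0.
  exists (absv w (map_poly iota (k *: \prod_(a <- rs) ('X - a%:P))).[iota c]).
  by exists (iota c) => //; apply/in_discR; rewrite ?subrr ?absv0 ltW.
apply/eqP; rewrite eq_le ge_sup//= leNgt; apply/negP => lt_sup.
have cvgA : A * t ^+ count P rs @[t --> s^'-] --> A * s ^+ count P rs.
  apply: cvg_at_left_filter; apply: cvgM; first exact: cvg_cst.
  exact: exprn_continuous.
(* If the supremum were smaller than the bound, some t < s would already have A t^m above it, by
   continuity. *)
have : \forall t \near s^'-, [/\ sup E < A * t ^+ count P rs, `|pi|v * `|b|v < t & t < s].
  near=> t; split; last by [].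
    by near: t; exact: (cvgr_gt _ cvgA).
  by near: t; exact: nbhs_left_gt.
move=> /filter_ex[t [sup_t pt ts]].
have t0 : 0 <= t by apply: ltW; exact: lt_trans pt.
have [|y /andP[ty ys]] := w_dense (r := t) (s := s); first by rewrite t0.
suff : A * absv w y ^+ count P rs <= sup E.
  apply/negP; rewrite -ltNge (lt_le_trans sup_t)// ler_wpM2l ?(ltW A0)//.
  by rewrite lerXn2r ?nnegrE ?absv_ge0// ltW.
apply: ub_le_sup; first by exists (A * s ^+ count P rs).
(* Since t < |y| < s, [|y|] differs from every [|c - a|], so each factor at c - y is exactly the
   larger of the two. *)
exists (iota c - y); first by apply/in_discR; rewrite ?subKr ltW.
rewrite absv_horner_split -valE; congr (_ * _); apply: eq_bigr => a _.
have -> : iota a - (iota c - y) = y - (iota c - iota a) by rewrite !opprB addrCA.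
have := absv_iotaB w_extends c a; set q := iota c - iota a => qE.
case: ifPn => Pa.
  rewrite absv_distC (@absvB_isosceles _ _ w 0) sub0r absvN// subr0 qE.
  by rewrite (le_lt_trans Pa)// (lt_trans pt).
rewrite (@absvB_isosceles _ _ w 0) sub0r absvN// subr0 qE.
by rewrite (lt_le_trans ys)// (le_trans sb)// farP.
Unshelve. all: by end_near. Qed.

(** The positive constant in the slope varies with the child, but only signs matter: a child with a
    root has negative slope, one without has slope 0. *)
Lemma steepest_contains_root (k : K) (rs : seq K) c b d :
  k != 0 -> b != 0 -> (exists2 a, a \in rs & `|c - a|v <= `|b|v) ->
  `|c - d|v <= `|b|v ->
  (forall C, children v (discR c `|b|v) C ->
    dir_derivative (v := v) (poly_abs (k *: \prod_(a <- rs) ('X - a%:P)))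
      (direction (discR c `|b|v) (discR d (`|pi|v * `|b|v))) <=
    dir_derivative (v := v) (poly_abs (k *: \prod_(a <- rs) ('X - a%:P)))
      (direction (discR c `|b|v) C)) ->
  exists2 a, a \in rs & `|d - a|v <= `|pi|v * `|b|v.
Proof.
move=> k0 b0 [a0 a0rs ca0] cd min_d.
set l := poly_abs _ in min_d.
have /andP[p0 p1] := pi_shrink pi01 b0.
have slope e : `|c - e|v <= `|b|v -> exists2 A : R, 0 < A &
    dir_derivative (v := v) l (direction (discR c `|b|v) (discR e (`|pi|v * `|b|v))) =
    - (A * (count (fun a => `|e - a|v <= `|pi|v * `|b|v) rs)%:R).
  move=> ce; set n := count _ _.
  (* Recentring the parent at [e] makes the path to the child radial. *)
  have -> : discR c `|b|v = discR e `|b|v by apply/eq_discR; rewrite ?absv_ge0.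
  set A := `|k|v * \prod_(a <- rs | ~~ (`|e - a|v <= `|pi|v * `|b|v)) `|e - a|v.
  have A0 : 0 < A.
    rewrite mulr_gt0 ?absv_gt0// prodr_gt0// => a; rewrite -ltNge.
    exact: lt_trans.
  exists (A * `|b|v ^+ n.-1); first by rewrite mulr_gt0// exprn_gt0// absv_gt0.
  rewrite -mulrA [_ * n%:R]mulrC.
  apply: (@dir_derivative_radial _ _ _ v w iota _ _ l (fun s => A * s ^+ n)) => //.
  - by rewrite (ltW p0).
  - by move=> s; rewrite in_itv/= => sb; rewrite /l (poly_abs_near rs e k0 b0 sb).
  - exact: cvg_quotient_monomial.
have /min_d : children v (discR c `|b|v) (discR a0 (`|pi|v * `|b|v)).
  by apply/(children_discR w_extends w_dense pi01 pi_gap) => //; exists a0.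
have [Ad Ad0 ->] := slope d cd; have [Aa Aa0 ->] := slope a0 ca0.
rewrite lerN2 => le_slopes.
suff : has (fun a => `|d - a|v <= `|pi|v * `|b|v) rs by move=> /hasP.
rewrite has_count lt0n; apply: contraTneq le_slopes => ->.
rewrite mulr0 -ltNge mulr_gt0// ltr0n -has_count.
by apply/hasP; exists a0 => //; rewrite subrr absv0 ltW.
Qed.

End RootProduct.

(** * Two tools for finding a common point of nested discs *)

Lemma cauchy_geometric (R : realType) (K : fieldType) (v : valuation R K)
    (x : nat -> valued v) (r t : R) : 0 < t < 1 ->
  (forall n, absv v ((x n : K) - x n.+1) <= r * t ^+ n) ->
  cauchy (x n @[n --> \oo]).
Proof.
move=> /andP[t0 t1] xS.
(* By the ultrametric inequality, a tail stays within the bound on its first jump. *)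
have xn n m : absv v ((x n : K) - x (n + m)%N) <= r * t ^+ n.
  elim: m => [|m IH].
    by rewrite addn0 subrr absv0; apply: le_trans (xS n); exact: absv_ge0.
  apply: absvB_trans_le IH _; rewrite addnS; apply: le_trans (xS _) _.
  have r0 : 0 <= r.
    by have := le_trans (absv_ge0 _ _) (xS 0%N); rewrite expr0 mulr1.
  by rewrite ler_wpM2l// exprD ler_piMr ?exprn_ge0 ?(ltW t0)// exprn_ile1 ?(ltW t0)// ltW.
apply: cauchy_exP => e e0.
have : r * t ^+ n @[n --> \oo] --> 0.
  rewrite -[X in _ --> X](mulr0 r); apply: cvgM; first exact: cvg_cst.
  by apply: cvg_expr; rewrite ger0_norm// ltW.
move=> /cvgr_lt /(_ e e0)[N _ Ne].
exists (x N); exists N => // n /= Nn.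
apply: le_lt_trans (Ne N (leqnn _)).
by rewrite -(subnKC Nn); exact: xn.
Qed.

(** If every [x] in [s] failed at some index [N x], then by monotonicity all would fail at the
    maximum of these indices. *)
Lemma common_witness (T : eqType) (s : seq T) (Q : nat -> T -> Prop) :
  (forall n x, Q n.+1 x -> Q n x) ->
  (forall n, exists2 x, x \in s & Q n x) ->
  exists2 x, x \in s & forall n, Q n x.
Proof.
move=> QS Qs; apply: contrapT => noQ.
have QD m n x : Q (n + m)%N x -> Q n x.
  by elim: m => [|m IH]; rewrite ?addn0// addnS => /QS.
have /choice[N NP] x : exists n, x \in s -> ~ Q n x.
  have [xs|xs] := boolP (x \in s); last by exists 0%N.
  apply: contrapT => /forallNP Qx; apply: noQ; exists x => // n.
  by apply: contrapT => nQ; apply: (Qx n).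
have [x xs QM] := Qs (\max_(y <- s) N y); apply: (NP x xs).
by apply: (QD (\max_(y <- s) N y - N x)%N); rewrite subnKC// leq_bigmax_seq.
Qed.

(** * Radii and centres along the descent *)

Section DescentSequence.
Context {R : realType} {K Khat : fieldType}.
Variables (v : valuation R K) (w : valuation R Khat).
Variable iota : {rmorphism K -> Khat}.
Hypothesis w_extends : forall a, w (iota a) = v a.
Hypothesis w_dense : absv_dense w.

Local Notation "`| a |v" := (absv v a) (at level 0, format "`| a |v").
Local Notation discR := (discR w iota).

Variable pi : K.
Hypothesis pi01 : 0 < `|pi|v < 1.
Hypothesis pi_gap : forall a b, `|a|v < `|b|v -> `|a|v <= `|pi|v * `|b|v.

Variables (l : discs w iota -> R) (B : nat -> discs w iota).
Hypothesis B_descent : best_first_descent v l B.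

Lemma descent_step n c b : b != 0 -> B n = discR c `|b|v ->
  exists d, [/\ `|c - d|v <= `|b|v, B n.+1 = discR d `|pi * b|v &
    forall C, children v (discR c `|b|v) C ->
      dir_derivative (v := v) l (direction (discR c `|b|v) (discR d (`|pi|v * `|b|v))) <=
      dir_derivative (v := v) l (direction (discR c `|b|v) C)].
Proof.
move=> b0 BE; have [D [[C + ->{D}]]] := B_descent n.
rewrite BE => /(children_discR w_extends w_dense pi01 pi_gap c C b0)[d cd ->{C}].
move=> min_d step; exists d; split=> //.
have dE : discR c `|b|v = discR d `|b|v by apply/(eq_discR w_extends w_dense); rewrite ?absv_ge0.
rewrite absvM; apply: (rational_step_child w_extends w_dense pi01 pi_gap b0).
by rewrite -dE.
Qed.

Lemma descent_centers a b : b != 0 -> B 0%N = discR a `|b|v ->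
  exists c : nat -> K,
    [/\ forall n, B n = discR (c n) `|pi ^+ n * b|v,
        forall n m, (n <= m)%N -> `|c n - c m|v <= `|pi ^+ n * b|v &
        forall n C, children v (B n) C ->
          dir_derivative (v := v) l (direction (B n) (B n.+1)) <=
          dir_derivative (v := v) l (direction (B n) C)].
Proof.
move=> b0 B0; have pi0 : pi != 0.
  by apply: contraTneq pi01 => ->; rewrite absv0 ltxx.
have pib n : pi ^+ n * b != 0 by rewrite mulf_neq0// expf_neq0.
(* The centres are chosen separately for each [n]; their mutual distances are recovered below from
   the inclusions of the discs. *)
have /choice[c cE] n : exists c, B n = discR c `|pi ^+ n * b|v.
  elim: n => [|n [c cE]]; first by exists a; rewrite expr0 mul1r.
  have [d [_ dE _]] := descent_step (pib n) cE.
  by exists d; rewrite exprS -mulrA.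
have sub n : val (B n.+1) `<=` val (B n).
  have [d [cd dE _]] := descent_step (pib n) (cE n).
  rewrite dE cE; apply/(discR_sub w_extends w_dense); rewrite ?absv_ge0//.
  by split=> //; rewrite absvM ltW//; case/andP: (pi_shrink pi01 (pib n)).
have subD n m : val (B (n + m)%N) `<=` val (B n).
  by elim: m => [|m IH]; rewrite ?addn0// addnS; exact: subset_trans (sub _) IH.
exists c; split=> // [n m nm|n C].
  have := subD n (m - n)%N; rewrite subnKC// !cE.
  by case/(discR_sub w_extends w_dense); rewrite ?absv_ge0.
have [d [cd dE min_d]] := descent_step (pib n) (cE n).
by rewrite dE cE (absvM v pi); exact: min_d.
Qed.

End DescentSequence.

(** * Convergence of the descent to a root *)

Theorem proposition81 (R : realType) (K Khat : fieldType)
    (v : valuation R K) (w : valuation R Khat) (iota : {rmorphism K -> Khat})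
    (v_nontrivial : nontrivial_valuation v)
    (v_complete : complete_valuation v)
    (Khat_closure : completed_algebraic_closure v w iota)
    (v_locally_compact : locally_compact_valuation v)
    (v_discrete : discrete_valuation v)
    (f : {poly K}) (f_splits : splits_over f)
    (B : nat -> discs w iota)
    (B0_rational : rational_disc v (B 0%N))
    (B0_radius : 0 < disc_radius (B 0%N))
    (B0_root : exists2 z : Khat, val (B 0%N) z & root (map_poly iota f) z)
    (B_descent : best_first_descent v (poly_abs f) B) :
  exists2 a : K, root f a &
    disc_dist v (B n) (mkdisc w iota a 0%:nng) @[n --> \oo] --> (0 : R).
Proof.
have w_ext : forall a, w (iota a) = v a by case: Khat_closure.
have w_dense := absv_closure_dense v_nontrivial Khat_closure.
have [pi pi01 pi_gap] := discrete_absv v_discrete.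
have [a0 [b B0]] := B0_rational; rewrite mkdiscE/= in B0.
have b0 : b != 0.
  apply: contraTneq B0_radius => b0; rewrite B0 (disc_radiusE w_ext w_dense) ?absv_ge0//.
  by rewrite b0 absv0 ltxx.
have pi0 : pi != 0.
  by apply: contraTneq pi01 => ->; rewrite absv0 ltxx.
have pib n : pi ^+ n * b != 0 by rewrite mulf_neq0// expf_neq0.
have [c [cE c_nested min_c]] := descent_centers w_ext w_dense pi01 pi_gap B_descent b0 B0.
have cvg_radius : absv v (pi ^+ n * b) @[n --> \oo] --> (0 : R).
  have -> : (fun n => absv v (pi ^+ n * b)) = (fun n => absv v pi ^+ n * absv v b).
    by apply/funext => n; rewrite absvM absvX.
  rewrite -[X in _ --> X](mul0r (absv v b)); apply: cvgM; last exact: cvg_cst.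
  by case/andP: pi01 => ? ?; apply: cvg_expr; rewrite ger0_norm// ltW.
(* The distance from a disc to a point inside it is the radius of the disc, so a root common to all
   the discs suffices. *)
suff [a fa ca] : exists2 a, root f a & forall n, absv v (c n - a) <= absv v (pi ^+ n * b).
  exists a => //; apply: cvg_trans cvg_radius; apply: near_eq_cvg; near=> n.
  rewrite cE mkdiscE (disc_distE w_ext w_dense) ?absv_ge0//= subr0.
  by rewrite (@max_l _ _ _ 0) ?absv_ge0// max_r// mulr2n addrK.
have [k [rs fE]] := f_splits; have [k0|k0] := eqVneq k 0.
  have /cvg_ex[a ca] : cvg ((c n : valued v) @[n --> \oo]).
    apply: v_complete; apply: (@cauchy_geometric _ _ _ _ (absv v b) (absv v pi)) => // n.
    by rewrite mulrC -absvX -absvM c_nested.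
  exists a => [|n]; first by rewrite fE k0 scale0r root0.
  have /(ca _) : nbhs (a : valued v) (ball (a : valued v) (absv v (pi ^+ n * b))).
    by apply: nbhsx_ballx; rewrite absv_gt0.
  (* The index is past [N], so the centre is close to [a], and past [n], so it lies in the [n]-th
     disc. *)
  move=> [N _ Nc]; apply: (@absvB_trans_le _ _ v (c (maxn N n))).
    by apply: c_nested; rewrite leq_maxr.
  by rewrite absv_distC ltW//; apply: Nc; rewrite /= leq_maxl.
have rootf a : a \in rs -> root f a.
  by move=> ars; rewrite fE rootZ// root_prod_XsubC.
suff [a ars ca] : exists2 a, a \in rs & forall n, absv v (c n - a) <= absv v (pi ^+ n * b).
  by exists a => //; exact: rootf.
apply: common_witness => [n a ca|n].
  apply: absvB_trans_le (c_nested _ _ (leqnSn n)) _; apply: le_trans ca _.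
  by rewrite exprS -mulrA absvM ltW//; case/andP: (pi_shrink pi01 (pib n)).
elim: n => [|n [a ars ca]].
  (* The given root lies in [Khat]; as [f] splits, it is the image of one of the listed roots in
     [K]. *)
  have [z z0] := B0_root; rewrite fE map_polyZ rootZ ?fmorph_eq0//.
  rewrite rmorph_prod /= => fz.
  have [a ars za] : exists2 a, a \in rs & z = iota a.
    move: fz; rewrite rootE horner_prod prodf_seq_eq0 => /hasP[a ars /=].
    by rewrite map_polyXsubC hornerXsubC subr_eq0 => /eqP; exists a.
  exists a => //; move: z0; rewrite za cE.
  by move=> /(in_discR_iota w_ext); apply; exact: absv_ge0.
have := min_c n; rewrite !cE exprS -mulrA (absvM v pi) fE => min_d.
have := steepest_contains_root w_ext w_dense pi01 pi_gap k0 (pib n) _ _ min_d.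
apply; first by exists a.
exact: c_nested.
Unshelve. all: by end_near. Qed.
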